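(* Let $R$ be a prime ring with extended centroid $C$, let $L$ be a noncentral Lie ideal of $R$, and let $a\in R$. Case 1: Suppose $L$ is not abelian. If $a\in R\setminus Z(R)$, then $L+aL$ contains a nonzero ideal of $R$. Case 2: Suppose $L$ is abelian. Then $LC=Cb+C$ for some $b\in L\setminus Z(R)$, and the following hold: (i) If $a\in LC$, then $L+aL$ does not contain any nonzero ideal of $R$; (ii) If $a\in [RC,RC]\setminus LC$, then $L+aL$ contains a nonzero ideal of $R$; (iii) If $a\notin [RC,RC]$, then $L+aL$ contains a nonzero ideal of $R$ if and only if $[a,b]$ is a unit of $RC$.
   Context: Rings are associative, not necessarily with unity; ''ideal'' means two-sided ideal. $Z(R)$ is the center of $R$, and $[x,y]:=xy-yx$. For subsets $A,B$ of a ring, $[A,B]$ (resp. $AB$) denotes the additive subgroup generated by all $[x,y]$ (resp. $xy$) with $x\in A$, $y\in B$. A Lie ideal of $R$ is an additive subgroup $L$ with $[L,R]\subseteq L$; it is abelian if $[L,L]=0$, central if $L\subseteq Z(R)$, and noncentral otherwise. $R$ is prime if $xRy=0$ implies $x=0$ or $y=0$. For $R$ prime, $Q_s(R)$ is the Martindale symmetric ring of quotients of $R$ (a prime ring containing $R$), and the extended centroid $C$ is the center of $Q_s(R)$, which is a field. $RC$ is the subring of $Q_s(R)$ consisting of finite sums of elements $rc$ ($r\in R$, $c\in C$), and $LC$ is the $C$-span of $L$ in $Q_s(R)$. $L+aL=\{x+ay: x,y\in L\}$ and $Cb+C=\{\beta b+\gamma:\beta,\gamma\in C\}$. *)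

(* Defs.v *)
(* MathComp, with classical sets from mathcomp-classical. *)
From HB Require Import structures.
From mathcomp Require Import all_boot all_algebra.
From mathcomp Require Import boolp classical_sets.

Set Implicit Arguments.
Unset Strict Implicit.
Unset Printing Implicit Defensive.

Import GRing.Theory.
Local Open Scope ring_scope.
Local Open Scope classical_set_scope.
Local Open Scope quotient_scope.

(* MathComp's rings all have a unity, so associative rings that need not have
   one get their own structure, with multiplication written [x ** y]. *)
HB.mixin Record Zmodule_isRng R of GRing.Zmodule R := {
  rmul : R -> R -> R;
  rmulA : associative rmul;
  rmulDl : left_distributive rmul +%R;
  rmulDr : right_distributive rmul +%R
}.

#[short(type="rngType")]
HB.structure Definition Rng := {R of GRing.Zmodule R & Zmodule_isRng R}.

Notation "x ** y" := (rmul x y) (at level 40, left associativity) : ring_scope.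

HB.mixin Record Rng_isPrime R of Rng R := {
  rng_nontrivial : exists x : R, x <> 0;
  rng_prime : forall x y : R,
    (forall r : R, x ** r ** y = 0) -> x = 0 \/ y = 0
}.

#[short(type="primeRngType")]
HB.structure Definition PrimeRng := {R of Rng R & Rng_isPrime R}.

Definition rcomm (R : rngType) (x y : R) : R := x ** y - y ** x.

Definition center (R : rngType) : set R := [set z | forall x, z ** x = x ** z].

Definition additive_subgroup (V : zmodType) (A : set V) : Prop :=
  A 0 /\ forall x y, A x -> A y -> A (x - y).

Definition add_span (V : zmodType) (X : set V) : set V :=
  smallest (@additive_subgroup V) X.

Definition set_mul (R : rngType) (A B : set R) : set R :=
  add_span [set x ** y | x in A & y in B].

Definition set_comm (R : rngType) (A B : set R) : set R :=
  add_span [set rcomm x y | x in A & y in B].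

Definition ideal (R : rngType) (I : set R) : Prop :=
  additive_subgroup I /\ forall x r, I x -> I (x ** r) /\ I (r ** x).

Definition nonzero_ideal (R : rngType) (I : set R) : Prop :=
  ideal I /\ exists2 x, I x & x <> 0.

Definition lie_ideal (R : rngType) (L : set R) : Prop :=
  additive_subgroup L /\ set_comm L [set: R] `<=` L.

Definition abelian_lie (R : rngType) (L : set R) : Prop :=
  set_comm L L = [set 0].

(* [S] need not share a unity with [R]; its unity is the [e] below. *)
Definition unit_of (R : rngType) (S : set R) (u : R) : Prop :=
  exists2 e, S e /\ (forall x, S x -> e ** x = x /\ x ** e = x) &
    S u /\ exists2 v, S v & u ** v = e /\ v ** u = e.

Section AdditiveSubgroups.
Variables (V : zmodType) (A : set V).
Hypothesis sgA : additive_subgroup A.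

Lemma subgroup0 : A 0. Proof. by case: sgA. Qed.

Lemma subgroupB x y : A x -> A y -> A (x - y).
Proof. by case: sgA => _; apply. Qed.

Lemma subgroupN x : A x -> A (- x).
Proof. by move=> Ax; rewrite -sub0r; apply: subgroupB => //; apply: subgroup0. Qed.

Lemma subgroupD x y : A x -> A y -> A (x + y).
Proof.
by move=> Ax Ay; rewrite -[y]opprK; apply: subgroupB => //; apply: subgroupN.
Qed.

End AdditiveSubgroups.

Section Spans.
Variables (V : zmodType).
Implicit Types X A : set V.

Lemma add_span_subgroup X : additive_subgroup (add_span X).
Proof.
split=> [A [[A0 _] _] //|x y Xx Xy A [sgA XA]].
by apply: subgroupB => //; [apply: Xx | apply: Xy].
Qed.

Lemma sub_add_span X : X `<=` add_span X.
Proof. exact: sub_gen_smallest. Qed.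

Lemma add_span_sub X A : additive_subgroup A -> X `<=` A -> add_span X `<=` A.
Proof. exact: smallest_sub. Qed.

End Spans.

Section RngTheory.
Variable R : rngType.
Implicit Types (x y z : R) (I J : set R).

Lemma rmulBl x y z : (x - y) ** z = x ** z - y ** z.
Proof. by apply: (@addIr _ (y ** z)); rewrite -rmulDl !subrK. Qed.

Lemma rmulBr x y z : x ** (y - z) = x ** y - x ** z.
Proof. by apply: (@addIr _ (x ** z)); rewrite -rmulDr !subrK. Qed.

Lemma rmul0l x : 0 ** x = 0.
Proof. by rewrite -[X in X ** x](subrr (0 : R)) rmulBl subrr. Qed.

Lemma rmul0r x : x ** 0 = 0.
Proof. by rewrite -[X in x ** X](subrr (0 : R)) rmulBr subrr. Qed.

Lemma idealT : ideal [set: R]. Proof. by []. Qed.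

Lemma idealI I J : ideal I -> ideal J -> ideal (I `&` J).
Proof.
move=> [sgI mI] [sgJ mJ]; split.
  split=> [|x y [Ix Jx] [Iy Jy]]; first by split; apply: subgroup0.
  by split; apply: subgroupB.
by move=> x r [/(mI _ r) [? ?] /(mJ _ r) [? ?]].
Qed.

Lemma ideal_mul I J : ideal I -> ideal J -> ideal (set_mul I J).
Proof.
move=> [sgI mI] [sgJ mJ]; have sgIJ := add_span_subgroup [set x ** y | x in I & y in J].
split=> // x r IJx; split; move: x IJx.
  apply: (@add_span_sub _ _ [set x | set_mul I J (x ** r)]).
    split=> [/=|x y /= hx hy]; first by rewrite rmul0l; exact: (subgroup0 sgIJ).
    by rewrite rmulBl; exact: (subgroupB sgIJ).
  move=> _ [x Ix [y Jy <-]] /=; apply: sub_add_span.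
  by exists x => //; exists (y ** r); [case: (mJ y r Jy) | rewrite rmulA].
apply: (@add_span_sub _ _ [set x | set_mul I J (r ** x)]).
  split=> [/=|x y /= hx hy]; first by rewrite rmul0r; exact: (subgroup0 sgIJ).
  by rewrite rmulBr; exact: (subgroupB sgIJ).
move=> _ [x Ix [y Jy <-]] /=; apply: sub_add_span.
by exists (r ** x); [case: (mI x r Ix) | exists y => //; rewrite rmulA].
Qed.

Lemma set_mul_subl I J : ideal I -> set_mul I J `<=` I.
Proof.
move=> [sgI mI]; apply: add_span_sub => // _ [x Ix [y _ <-]].
by case: (mI x y Ix).
Qed.

End RngTheory.

Section PrimeIdeals.
Variable R : primeRngType.
Implicit Types I J : set R.

Lemma nz_idealT : nonzero_ideal [set: R].
Proof. by split; [exact: idealT | case: (@rng_nontrivial R) => x; exists x]. Qed.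

Lemma nz_ideal_mul I J :
  nonzero_ideal I -> nonzero_ideal J -> nonzero_ideal (set_mul I J).
Proof.
move=> [idI [x Ix x0]] [idJ [y Jy y0]]; split; first exact: ideal_mul.
have [r xry0] : exists r, x ** r ** y <> 0.
  by apply/existsNP => h; case: (@rng_prime R x y h).
exists (x ** r ** y) => //; apply: sub_add_span.
by exists (x ** r); [case: idI => _ /(_ x r Ix) [] | exists y].
Qed.

Lemma nz_idealI I J :
  nonzero_ideal I -> nonzero_ideal J -> nonzero_ideal (I `&` J).
Proof.
move=> nzI nzJ; split; first by apply: idealI; [case: nzI | case: nzJ].
have [_ [z IJz z0]] := nz_ideal_mul nzI nzJ; exists z => //; split.
  by apply: set_mul_subl IJz; case: nzI.
move: z IJz {z0}; case: nzJ => [[sgJ mJ] _]; apply: add_span_sub => //.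
by move=> _ [x _ [y Jy <-]]; case: (mJ y x Jy).
Qed.

End PrimeIdeals.

(* The Martindale symmetric ring of quotients is the set of germs, along nonzero
   ideals [I] of [R], of pairs consisting of a right module map [lact : I -> R]
   (thought of as [x |-> q x]) and a left module map [ract : I -> R] (thought of
   as [x |-> x q]) with [(x q) y = x (q y)].  The maps are total functions
   whose values outside [dom] are irrelevant. *)
Record double_centralizer (R : rngType) := DoubleCentralizer {
  dom : set R;
  lact : R -> R;
  ract : R -> R;
  dom_nz_ideal : nonzero_ideal dom;
  lactD : forall x y, dom x -> dom y -> lact (x + y) = lact x + lact y;
  lactM : forall x r, dom x -> lact (x ** r) = lact x ** r;
  ractD : forall x y, dom x -> dom y -> ract (x + y) = ract x + ract y;
  ractM : forall r x, dom x -> ract (r ** x) = r ** ract x;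
  ract_lact : forall x y, dom x -> dom y -> ract x ** y = x ** lact y
}.

HB.instance Definition _ (R : rngType) :=
  gen_eqMixin (double_centralizer R).
HB.instance Definition _ (R : rngType) :=
  gen_choiceMixin (double_centralizer R).

Definition dc_eqv (R : rngType) (p q : double_centralizer R) : Prop :=
  exists J, [/\ nonzero_ideal J, J `<=` dom p `&` dom q &
    forall x, J x -> lact p x = lact q x /\ ract p x = ract q x].

Section Operations.
Variable R : primeRngType.
Implicit Types (p q r : double_centralizer R) (I J : set R).

Lemma dom_ideal p : ideal (dom p). Proof. by case: (dom_nz_ideal p). Qed.

Lemma dom_subgroup p : additive_subgroup (dom p).
Proof. by case: (dom_ideal p). Qed.

Lemma lact0 p : lact p 0 = 0.
Proof.
have d0 := subgroup0 (dom_subgroup p).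
by apply: (@addIr _ (lact p 0)); rewrite -lactD // !add0r.
Qed.

Lemma ract0 p : ract p 0 = 0.
Proof.
have d0 := subgroup0 (dom_subgroup p).
by apply: (@addIr _ (ract p 0)); rewrite -ractD // !add0r.
Qed.

Lemma lactB p x y : dom p x -> dom p y -> lact p (x - y) = lact p x - lact p y.
Proof.
move=> px py; have pxy := subgroupB (dom_subgroup p) px py.
by apply: (@addIr _ (lact p y)); rewrite -(lactD pxy py) !subrK.
Qed.

Lemma ractB p x y : dom p x -> dom p y -> ract p (x - y) = ract p x - ract p y.
Proof.
move=> px py; have pxy := subgroupB (dom_subgroup p) px py.
by apply: (@addIr _ (ract p y)); rewrite -(ractD pxy py) !subrK.
Qed.

Lemma lact_set_mul p I J x : ideal I -> I `<=` dom p -> ideal J ->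
  set_mul I J x -> J (lact p x).
Proof.
move=> idI sIp [sgJ mJ] /(_ ([set x | I x /\ J (lact p x)])) [] //.
split; first split.
- by split; [apply: subgroup0; case: idI | rewrite lact0; apply: subgroup0].
- move=> {}x y [Ix Jx] [Iy Jy]; split; first by apply: subgroupB => //; case: idI.
  by rewrite lactB; [apply: subgroupB | apply: sIp | apply: sIp].
- move=> _ [{}x Ix [y Jy <-]]; split; first by case: idI => _ /(_ x y Ix) [].
  by rewrite lactM; [case: (mJ y (lact p x) Jy) | apply: sIp].
Qed.

Lemma ract_set_mul p I J x : ideal I -> I `<=` dom p -> ideal J ->
  set_mul J I x -> J (ract p x).
Proof.
move=> idI sIp [sgJ mJ] /(_ ([set x | I x /\ J (ract p x)])) [] //.
split; first split.
- by split; [apply: subgroup0; case: idI | rewrite ract0; apply: subgroup0].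
- move=> {}x y [Ix Jx] [Iy Jy]; split; first by apply: subgroupB => //; case: idI.
  by rewrite ractB; [apply: subgroupB | apply: sIp | apply: sIp].
- move=> _ [y Jy [{}x Ix <-]]; split; first by case: idI => _ /(_ x y Ix) [].
  by rewrite ractM; [case: (mJ y (ract p x) Jy) | apply: sIp].
Qed.

Lemma dc_eqv_refl p : dc_eqv p p.
Proof. by exists (dom p); split=> //; exact: dom_nz_ideal. Qed.

Lemma dc_eqv_sym p q : dc_eqv p q -> dc_eqv q p.
Proof.
move=> [J [nzJ sJ e]]; exists J; split=> //; first by rewrite setIC.
by move=> x /e [-> ->].
Qed.

Lemma dc_eqv_trans q p r : dc_eqv p q -> dc_eqv q r -> dc_eqv p r.
Proof.
move=> [I [nzI sI eI]] [J [nzJ sJ eJ]]; exists (I `&` J); split.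
- exact: nz_idealI.
- by move=> x [/sI [? _] /sJ [_ ?]].
- by move=> x [/eI [-> ->] /eJ [-> ->]].
Qed.

Lemma dc_eqv_on p q :
  (forall x, dom p x -> dom q x -> lact p x = lact q x /\ ract p x = ract q x) ->
  dc_eqv p q.
Proof.
move=> e; exists (dom p `&` dom q); split=> //; last by move=> x []; exact: e.
by apply: nz_idealI; exact: dom_nz_ideal.
Qed.

Definition dc_of (a : R) : double_centralizer R.
Proof.
exists [set: R] (fun x => a ** x) (fun x => x ** a).
- exact: nz_idealT.
- by move=> x y _ _; rewrite rmulDr.
- by move=> x r _; rewrite rmulA.
- by move=> x y _ _; rewrite rmulDl.
- by move=> r x _; rewrite rmulA.
- by move=> x y _ _; rewrite rmulA.
Defined.

Definition dc_opp p : double_centralizer R.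
Proof.
exists (dom p) (fun x => - lact p x) (fun x => - ract p x).
- exact: dom_nz_ideal.
- by move=> x y px py; rewrite lactD // opprD.
- by move=> x r px; rewrite lactM // -[in RHS]sub0r rmulBl rmul0l sub0r.
- by move=> x y px py; rewrite ractD // opprD.
- by move=> r x px; rewrite ractM // -[in RHS]sub0r rmulBr rmul0r sub0r.
- move=> x y px py; rewrite -[- ract p x]sub0r -[- lact p y]sub0r.
  by rewrite rmulBl rmulBr rmul0l rmul0r ract_lact.
Defined.

Definition dc_add p q : double_centralizer R.
Proof.
exists (dom p `&` dom q) (fun x => lact p x + lact q x)
                         (fun x => ract p x + ract q x).
- by apply: nz_idealI; exact: dom_nz_ideal.
- by move=> x y [px qx] [py qy]; rewrite !lactD // addrACA.
- by move=> x r [px qx]; rewrite !lactM // rmulDl.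
- by move=> x y [px qx] [py qy]; rewrite !ractD // addrACA.
- by move=> r x [px qx]; rewrite !ractM // rmulDr.
- by move=> x y [px qx] [py qy]; rewrite rmulDl rmulDr !ract_lact.
Defined.

(* The composites are defined on the square of [dom p `&` dom q]. *)
Definition dc_mul_dom p q : set R :=
  set_mul (dom p `&` dom q) (dom p `&` dom q).

Lemma dc_mul_domP p q x : dc_mul_dom p q x ->
  [/\ dom p x, dom q x, dom p (lact q x) & dom q (ract p x)].
Proof.
move=> Kx; have idpq := idealI (dom_ideal p) (dom_ideal q).
have [px qx] := set_mul_subl idpq Kx; split=> //.
  by have [] := lact_set_mul idpq (@subIsetr _ _ _) idpq Kx.
by have [] := ract_set_mul idpq (@subIsetl _ _ _) idpq Kx.
Qed.

Definition dc_mul p q : double_centralizer R.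
Proof.
exists (dc_mul_dom p q) (fun x => lact p (lact q x))
                        (fun x => ract q (ract p x)).
- by apply: nz_ideal_mul; apply: nz_idealI; exact: dom_nz_ideal.
- by move=> x y /dc_mul_domP[? ? ? ?] /dc_mul_domP[? ? ? ?]; rewrite !lactD.
- by move=> x r /dc_mul_domP[? ? ? ?]; rewrite !lactM.
- by move=> x y /dc_mul_domP[? ? ? ?] /dc_mul_domP[? ? ? ?]; rewrite !ractD.
- by move=> r x /dc_mul_domP[? ? ? ?]; rewrite !ractM.
- by move=> x y /dc_mul_domP[? ? ? ?] /dc_mul_domP[? ? ? ?]; rewrite !ract_lact.
Defined.

Lemma dc_opp_eqv p p' : dc_eqv p p' -> dc_eqv (dc_opp p) (dc_opp p').
Proof. by move=> [J [nzJ sJ e]]; exists J; split=> // x /e /= [-> ->]. Qed.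

Lemma dc_add_eqv p p' q q' : dc_eqv p p' -> dc_eqv q q' ->
  dc_eqv (dc_add p q) (dc_add p' q').
Proof.
move=> [I [nzI sI eI]] [J [nzJ sJ eJ]]; exists (I `&` J); split.
- exact: nz_idealI.
- by move=> x [/sI [? ?] /sJ [? ?]].
- by move=> x [/eI /= [-> ->] /eJ [-> ->]].
Qed.

Lemma dc_mul_eqv p p' q q' : dc_eqv p p' -> dc_eqv q q' ->
  dc_eqv (dc_mul p q) (dc_mul p' q').
Proof.
move=> [I [nzI sI eI]] [J [nzJ sJ eJ]].
have nzK := nz_idealI nzI nzJ; have [idK _] := nzK.
have sKp : I `&` J `<=` dom p by move=> x [/sI []].
have sKq : I `&` J `<=` dom q by move=> x [_ /sJ []].
exists (set_mul (I `&` J) (I `&` J)); split; first exact: nz_ideal_mul.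
  move=> x; apply: add_span_sub; first by
    apply: (proj1 (idealI (dom_ideal (dc_mul p q)) (dom_ideal (dc_mul p' q')))).
  move=> _ [y [/sI [? ?] /sJ [? ?]] [z [/sI [? ?] /sJ [? ?]] <-]].
  by split; apply: sub_add_span; exists y => //; exists z.
move=> x Kx; have [Ix Jx] := set_mul_subl idK Kx.
have [Iqx _] := lact_set_mul idK sKq idK Kx.
have [_ Jpx] := ract_set_mul idK sKp idK Kx.
move: (eI _ Ix) (eJ _ Jx) (eI _ Iqx) (eJ _ Jpx) => /= [_ ep] [eq _] [-> _] [_ ->].
by rewrite ep eq.
Qed.

Definition dc_eqvb p q : bool := `[< dc_eqv p q >].

Lemma dc_eqvb_refl : reflexive dc_eqvb.
Proof. by move=> p; apply/asboolP; exact: dc_eqv_refl. Qed.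

Lemma dc_eqvb_sym : symmetric dc_eqvb.
Proof. by move=> p q; apply/asboolP/asboolP => /dc_eqv_sym. Qed.

Lemma dc_eqvb_trans : transitive dc_eqvb.
Proof.
by move=> q p r /asboolP pq /asboolP qr; apply/asboolP; exact: dc_eqv_trans qr.
Qed.

Definition dc_equiv := EquivRel dc_eqvb dc_eqvb_refl dc_eqvb_sym dc_eqvb_trans.

End Operations.

Definition Qs (R : primeRngType) : Type := {eq_quot (@dc_equiv R)}.

Section QsRing.
Variable R : primeRngType.
Implicit Types (p q r : double_centralizer R) (u v w : Qs R).

HB.instance Definition _ := Choice.on (Qs R).

Definition Qs_pi p : Qs R := \pi_{eq_quot (@dc_equiv R)} p.
Definition Qs_repr u : double_centralizer R :=
  repr (u : {eq_quot (@dc_equiv R)}).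

Lemma Qs_piE p q : Qs_pi p = Qs_pi q <-> dc_eqv p q.
Proof. by split=> [/eqmodP /asboolP|] // pq; apply/eqmodP/asboolP. Qed.

Lemma Qs_piP u : Qs_pi (Qs_repr u) = u.
Proof. exact: reprK. Qed.

Lemma Qs_reprP p : dc_eqv (Qs_repr (Qs_pi p)) p.
Proof. by apply/Qs_piE; rewrite Qs_piP. Qed.

Lemma Qs_ind (P : Qs R -> Prop) : (forall p, P (Qs_pi p)) -> forall u, P u.
Proof. by move=> h u; rewrite -(Qs_piP u). Qed.

Definition Qs_opp u : Qs R := Qs_pi (dc_opp (Qs_repr u)).
Definition Qs_add u v : Qs R := Qs_pi (dc_add (Qs_repr u) (Qs_repr v)).
Definition Qs_mul u v : Qs R := Qs_pi (dc_mul (Qs_repr u) (Qs_repr v)).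

Lemma Qs_oppE p : Qs_opp (Qs_pi p) = Qs_pi (dc_opp p).
Proof. by apply/Qs_piE/dc_opp_eqv/Qs_reprP. Qed.

Lemma Qs_addE p q : Qs_add (Qs_pi p) (Qs_pi q) = Qs_pi (dc_add p q).
Proof. by apply/Qs_piE/dc_add_eqv; exact: Qs_reprP. Qed.

Lemma Qs_mulE p q : Qs_mul (Qs_pi p) (Qs_pi q) = Qs_pi (dc_mul p q).
Proof. by apply/Qs_piE/dc_mul_eqv; exact: Qs_reprP. Qed.

Lemma Qs_addA : associative Qs_add.
Proof.
elim/Qs_ind => p; elim/Qs_ind => q; elim/Qs_ind => r.
by rewrite !Qs_addE; apply/Qs_piE/dc_eqv_on => x _ _ /=; rewrite !addrA.
Qed.

Lemma Qs_addC : commutative Qs_add.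
Proof.
elim/Qs_ind => p; elim/Qs_ind => q.
rewrite !Qs_addE; apply/Qs_piE/dc_eqv_on => x _ _ /=.
by split; rewrite addrC.
Qed.

Lemma Qs_add0 : left_id (Qs_pi (dc_of (0 : R))) Qs_add.
Proof.
elim/Qs_ind => p; rewrite Qs_addE; apply/Qs_piE/dc_eqv_on => x _ _ /=.
by rewrite rmul0l rmul0r !add0r.
Qed.

Lemma Qs_addN : left_inverse (Qs_pi (dc_of (0 : R))) Qs_opp Qs_add.
Proof.
elim/Qs_ind => p; rewrite Qs_oppE Qs_addE; apply/Qs_piE/dc_eqv_on => x _ _ /=.
by rewrite rmul0l rmul0r !addNr.
Qed.

HB.instance Definition _ :=
  GRing.isZmodule.Build (Qs R) Qs_addA Qs_addC Qs_add0 Qs_addN.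

Lemma Qs_mulA : associative Qs_mul.
Proof.
elim/Qs_ind => p; elim/Qs_ind => q; elim/Qs_ind => r.
by rewrite !Qs_mulE; apply/Qs_piE/dc_eqv_on.
Qed.

Lemma Qs_mulDl : left_distributive Qs_mul (@GRing.add (Qs R)).
Proof.
elim/Qs_ind => p; elim/Qs_ind => q; elim/Qs_ind => r.
rewrite /GRing.add /= !(Qs_addE, Qs_mulE); apply/Qs_piE/dc_eqv_on => x _ /=.
by move=> [/dc_mul_domP[? ? ? ?] /dc_mul_domP[? ? ? ?]]; rewrite ractD.
Qed.

Lemma Qs_mulDr : right_distributive Qs_mul (@GRing.add (Qs R)).
Proof.
elim/Qs_ind => p; elim/Qs_ind => q; elim/Qs_ind => r.
rewrite /GRing.add /= !(Qs_addE, Qs_mulE); apply/Qs_piE/dc_eqv_on => x _ /=.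
by move=> [/dc_mul_domP[? ? ? ?] /dc_mul_domP[? ? ? ?]]; rewrite lactD.
Qed.

HB.instance Definition _ :=
  Zmodule_isRng.Build (Qs R) Qs_mulA Qs_mulDl Qs_mulDr.

Definition Qs_of (a : R) : Qs R := Qs_pi (dc_of a).

Lemma Qs_ofD a b : Qs_of (a + b) = Qs_of a + Qs_of b.
Proof.
rewrite /Qs_of /GRing.add /= Qs_addE; apply/Qs_piE/dc_eqv_on => x _ _ /=.
by rewrite rmulDl rmulDr.
Qed.

Lemma Qs_ofM a b : Qs_of (a ** b) = Qs_of a ** Qs_of b.
Proof.
rewrite /Qs_of /rmul /= Qs_mulE; apply/Qs_piE/dc_eqv_on => x _ _ /=.
by rewrite !rmulA.
Qed.

Lemma Qs_of_inj : injective Qs_of.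
Proof.
move=> a b /Qs_piE [J [[[_ mJ] [x Jx x0]] _ e]].
case: (@rng_prime R (a - b) x) => // [r|/eqP]; last by rewrite subr_eq0 => /eqP.
rewrite -rmulA rmulBl; apply/eqP; rewrite subr_eq0; apply/eqP.
by case: (mJ x r Jx) => _ /e [].
Qed.

End QsRing.

Definition extended_centroid (R : primeRngType) : set (Qs R) := @center (Qs R).

(* [AC], the [C]-span of the image of [A] in the ring of quotients. *)
Definition central_span (R : primeRngType) (A : set R) : set (Qs R) :=
  set_mul (@Qs_of R @` A) (@extended_centroid R).

Definition add_lmul (R : rngType) (a : R) (L : set R) : set R :=
  [set x + a ** y | x in L & y in L].

Definition contains_nz_ideal (R : rngType) (S : set R) : Prop :=
  exists2 I, nonzero_ideal I & I `<=` S.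

(* Main.v *)
(* Write d for [b, -].

   If [L, L] <> 0, then the ideal I = R[L, L]R satisfies [I, R] <= L, and
   [a, r] x = [a x, r] - a [x, r] shows that the nonzero ideal [a, R] I lies in
   L + a L.

   If [L, L] = 0 and b in L is noncentral, then an element u commuting with d(R)
   satisfies d(x) y [u, z] = - [u, x] y d(z), so by Martindale's lemma
   [u, -] = lambda d with lambda in C, that is, u is in C b + C.  This yields
   LC = C b + C, and also d([x, y]) in C for x, y in RC, with a nonzero value on
   every nonzero ideal.  Everything then follows from the equivalence: L + a L
   contains a nonzero ideal iff c = [a, b] is a unit of RC.  If u + a v = [x, y],
   then - c v = d([x, y]), a nonzero scalar when x and y are well chosen in the
   ideal.  Conversely put w = a c^-1, so that [w, b] = 1.  Every k commuting with
   b is [w k, b], hence is in L as soon as w k is in R; apply this to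
   k2 = c^-1 [y, b] and k1 = y - a k2, for y in a small enough ideal. *)
Require Import Defs.
From mathcomp Require Import all_boot all_algebra.
From mathcomp Require Import boolp classical_sets.

Set Implicit Arguments.
Unset Strict Implicit.
Unset Printing Implicit Defensive.

Local Open Scope ring_scope.
Import GRing.Theory.
Local Open Scope classical_set_scope.

(** * Commutator identities and Lie ideals *)

Section RngLemmas.
Variable R : rngType.
Implicit Types (x y z r s : R) (L S : set R).

Lemma rmulNl x y : (- x) ** y = - (x ** y).
Proof. by rewrite -sub0r rmulBl rmul0l sub0r. Qed.

Lemma rmulNr x y : x ** (- y) = - (x ** y).
Proof. by rewrite -sub0r rmulBr rmul0r sub0r. Qed.

Lemma rcomm_anti x y : rcomm x y = - rcomm y x.
Proof. by rewrite /rcomm opprB. Qed.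

Lemma rcommBl x y z : rcomm (x - y) z = rcomm x z - rcomm y z.
Proof. by rewrite /rcomm rmulBl rmulBr opprD addrACA -opprD. Qed.

Lemma rcommBr x y z : rcomm x (y - z) = rcomm x y - rcomm x z.
Proof.
rewrite rcomm_anti rcommBl opprB.
by rewrite [rcomm y x]rcomm_anti [rcomm z x]rcomm_anti opprK addrC.
Qed.

Lemma rcommNr x y : rcomm x (- y) = - rcomm x y.
Proof. by rewrite /rcomm rmulNl rmulNr opprD. Qed.

Lemma rcommDl x y z : rcomm (x + y) z = rcomm x z + rcomm y z.
Proof. by rewrite /rcomm rmulDl rmulDr opprD addrACA. Qed.

Lemma rcommDr x y z : rcomm x (y + z) = rcomm x y + rcomm x z.
Proof. by rewrite /rcomm rmulDl rmulDr opprD addrACA. Qed.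

Lemma rcommMr x y z : rcomm x (y ** z) = rcomm x y ** z + y ** rcomm x z.
Proof. by rewrite /rcomm rmulBl rmulBr !rmulA addrA subrK. Qed.

Lemma rcommMl x y z : rcomm (x ** y) z = x ** rcomm y z + rcomm x z ** y.
Proof. by rewrite /rcomm rmulBl rmulBr !rmulA addrA subrK. Qed.

Lemma rcomm_cycle x y z : rcomm (x ** y) z = rcomm x (y ** z) + rcomm y (z ** x).
Proof. by rewrite /rcomm !rmulA addrA subrK. Qed.

Lemma rcomm_jacobi x y z :
  rcomm x (rcomm y z) = rcomm (rcomm x y) z + rcomm y (rcomm x z).
Proof.
rewrite [rcomm y z in LHS]/rcomm rcommBr !rcommMr opprD.
by rewrite [- _ - _]addrC addrACA.
Qed.

Lemma rcomm_eq0 x y : rcomm x y = 0 <-> x ** y = y ** x.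
Proof. by rewrite /rcomm; split=> [/eqP|->]; rewrite ?subrr // subr_eq0 => /eqP. Qed.

Lemma add_lmul_subgroup (a : R) L :
  additive_subgroup L -> additive_subgroup (add_lmul a L).
Proof.
move=> sgL; split=> [|_ _ [x Lx [y Ly <-]] [x' Lx' [y' Ly' <-]]].
  by exists 0; [|exists 0]; rewrite ?rmul0r ?addr0 //; exact: subgroup0.
exists (x - x'); first exact: subgroupB.
by exists (y - y'); [exact: subgroupB|rewrite rmulBr opprD addrACA].
Qed.

Lemma central_subgroup : additive_subgroup (@center R).
Proof.
split=> [x|x y cx cy z]; first by rewrite rmul0l rmul0r.
by rewrite rmulBl rmulBr cx cy.
Qed.

Lemma centerM x y : center x -> center y -> center (x ** y).
Proof. by move=> cx cy z; rewrite -rmulA cy rmulA cx -rmulA. Qed.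

Section LieIdeal.
Variable L : set R.
Hypothesis lieL : lie_ideal L.

Lemma lie_sub : additive_subgroup L. Proof. by case: lieL. Qed.

Lemma lie_rcomm x r : L x -> L (rcomm x r).
Proof.
move=> Lx; case: lieL => _; apply; apply: sub_add_span.
by exists x => //; exists r.
Qed.

Lemma lie_rcommr r x : L x -> L (rcomm r x).
Proof.
move=> Lx; rewrite rcomm_anti; apply: (subgroupN lie_sub).
exact: lie_rcomm.
Qed.

(** A subring containing [L], whereas [L] need not be closed under products; this makes it a place
    to look for ideals. *)
Definition lie_idealizer : set R := [set x | forall r, L (rcomm x r)].

(** The cyclic identity [[xy, r] = [x, yr] + [y, rx]] splits the claim between the factors. *)
Lemma lie_idealizerM x y :
  lie_idealizer x -> lie_idealizer y -> lie_idealizer (x ** y).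
Proof. by move=> Tx Ty r; rewrite rcomm_cycle; apply: (subgroupD lie_sub). Qed.

Lemma lie_idealizer_subgroup : additive_subgroup lie_idealizer.
Proof.
split=> [r|x y Tx Ty r]; last first.
  by rewrite rcommBl; apply: subgroupB => //; exact: lie_sub.
by rewrite /rcomm rmul0l rmul0r subrr; exact: subgroup0 lie_sub.
Qed.

Lemma lie_idealizer_lie x : L x -> lie_idealizer x.
Proof. by move=> Lx r; exact: lie_rcomm. Qed.

(** First [[u,v] t = [u, vt] - v [u,t]], where [[u, vt]], [v] and [[u,t]] lie in [L]. The left
    factor then comes from [s [u,v] r = [u,v] r s - [[u,v] r, s]], whose last term is in [L]. *)
Lemma lie_idealizer_ideal u v s r :
  L u -> L v -> lie_idealizer (s ** rcomm u v ** r).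
Proof.
move=> Lu Lv; have T t : lie_idealizer (rcomm u v ** t).
  have -> : rcomm u v ** t = rcomm u (v ** t) - v ** rcomm u t.
    by rewrite rcommMr addrK.
  apply: (subgroupB lie_idealizer_subgroup).
    by apply/lie_idealizer_lie/lie_rcomm.
  by apply: lie_idealizerM; apply: lie_idealizer_lie => //; exact: lie_rcomm.
have -> : s ** rcomm u v ** r = rcomm u v ** (r ** s) - rcomm (rcomm u v ** r) s.
  by rewrite [X in _ - X]/rcomm opprB !rmulA addrC subrK.
by apply: (subgroupB lie_idealizer_subgroup) => //; apply: lie_idealizer_lie; exact: T.
Qed.

End LieIdeal.

Lemma nonabelian_lie L :
  ~ abelian_lie L -> exists u v, [/\ L u, L v & rcomm u v <> 0].
Proof.
move=> nabL; apply: contrapT => h; apply: nabL.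
rewrite /abelian_lie eqEsubset; split=> [|_ ->]; last first.
  exact: subgroup0 (add_span_subgroup _).
apply: add_span_sub => [|_ [u Lu [v Lv <-]]].
  by split=> // x y -> ->; rewrite subrr.
by apply: contrapT => uv0; apply: h; exists u, v.
Qed.

Lemma abelian_rcomm L x y : abelian_lie L -> L x -> L y -> rcomm x y = 0.
Proof.
move=> abL Lx Ly; have : set_comm L L (rcomm x y).
  by apply: sub_add_span; exists x => //; exists y.
by rewrite abL.
Qed.

End RngLemmas.

(** * Prime rings and nonabelian Lie ideals *)

Section PrimeLemmas.
Variable R : primeRngType.
Implicit Types (x y z r s : R) (S I J : set R).

Lemma prime_mul3 x y :
  x <> 0 -> (forall r, x ** r ** y = 0) -> y = 0.
Proof. by move=> x0 /(@rng_prime R) []. Qed.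

(** In the absence of a unity, a fixed nonzero [y] is put on both sides: [y s x r y = 0] gives
    [y s x = 0], hence [x = 0]. *)
Lemma prime_sandwich x : (forall s r, s ** x ** r = 0) -> x = 0.
Proof.
move=> h; have [y y0] := @rng_nontrivial R.
apply: (prime_mul3 y0) => s; case: (@rng_prime R (y ** s ** x) y) => // r.
by rewrite -[y ** s ** x]rmulA -[y ** _ ** r]rmulA h rmul0r rmul0l.
Qed.

Lemma ideal_annihilator I x : nonzero_ideal I -> (forall y, I y -> x ** y = 0) -> x = 0.
Proof.
move=> [[_ mI] [y Iy y0]] h; case: (@rng_prime R x y) => // r.
by rewrite -rmulA h //; case: (mI y r Iy).
Qed.

(** The witness is the largest ideal inside [S]. Since there may be no unity, the four kinds of
    multiples are required separately. *)
Lemma sub_contains_nz_ideal S x : additive_subgroup S -> x <> 0 ->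
  (forall s r, S (s ** x ** r)) -> contains_nz_ideal S.
Proof.
move=> sgS x0 Sx; have [s [r sxr0]] : exists s r, s ** x ** r <> 0.
  apply: contrapT => h; apply/x0/prime_sandwich => s r.
  by apply: contrapT => sxr0; apply: h; exists s, r.
exists [set y | [/\ S y, forall t, S (t ** y), forall t, S (y ** t) &
    forall t t', S (t ** y ** t')]]; last by move=> y [].
split; last first.
  exists (s ** x ** r) => //; split=> [//|t|t|t t']; rewrite ?rmulA //.
    by rewrite -rmulA.
  by rewrite -[_ ** r ** t']rmulA.
split; first split.
- by split=> *; rewrite ?(rmul0l, rmul0r); exact: subgroup0.
- move=> y z [y1 y2 y3 y4] [z1 z2 z3 z4].
  by split=> *; rewrite ?(rmulBl, rmulBr); exact: subgroupB.
- move=> y t [y1 y2 y3 y4]; split; split=> *; rewrite ?rmulA //.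
  + by rewrite -rmulA.
  + by rewrite -rmulA.
Qed.

Lemma nonabelian_contains_nz_ideal L (a : R) :
  lie_ideal L -> ~ abelian_lie L -> ~ center a -> contains_nz_ideal (add_lmul a L).
Proof.
move=> lieL /nonabelian_lie [u [v [Lu Lv uv0]]] /existsNP [r0 ar0].
have [I [[sgI mI] [x Ix x0]] IT] : contains_nz_ideal (lie_idealizer L).
  apply: sub_contains_nz_ideal uv0 _; first exact: lie_idealizer_subgroup.
  by move=> s r; exact: lie_idealizer_ideal.
have sgS := add_lmul_subgroup a (lie_sub lieL).
have Sa r y : I y -> add_lmul a L (rcomm a r ** y).
  move=> Iy; exists (rcomm (a ** y) r); first by apply: IT; case: (mI y a Iy).
  exists (- rcomm y r); first by apply: (subgroupN (lie_sub lieL)); exact: IT.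
  by rewrite rcommMl rmulNr addrC addKr.
have [t art0] : exists t, rcomm a r0 ** t ** x <> 0.
  by apply/existsNP => h; case: (@rng_prime R (rcomm a r0) x h) => // /rcomm_eq0.
apply: (sub_contains_nz_ideal sgS art0) => s r.
have Itx : I (t ** x ** r) by case: (mI (t ** x) r) => //; case: (mI x t Ix).
(* Left factors are absorbed through [s [a,r0] = [a, s r0] - [a,s] r0], so that [Sa] applies to both
   terms. *)
have -> : s ** (rcomm a r0 ** t ** x) ** r =
    rcomm a (s ** r0) ** (t ** x ** r) - rcomm a s ** (r0 ** (t ** x ** r)).
  by rewrite rcommMr [(_ + s ** _) ** _]rmulDl !rmulA addrC addKr.
by apply: (subgroupB sgS); apply: Sa => //; case: (mI (t ** x ** r) r0 Itx).
Qed.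

End PrimeLemmas.

(** * The symmetric ring of quotients and its center *)

Section Quotients.
Variable R : primeRngType.
Local Notation j := (@Qs_of R).
Local Notation C := (@extended_centroid R).
Implicit Types (x y z r s : R) (I J : set R) (q u v : Qs R).

Lemma Qs_of0 : j 0 = 0.
Proof. by apply: (@addIr _ (j 0)); rewrite -Qs_ofD !add0r. Qed.

Lemma Qs_ofB x y : j (x - y) = j x - j y.
Proof. by apply: (@addIr _ (j y)); rewrite -Qs_ofD !subrK. Qed.

Lemma Qs_ofN x : j (- x) = - j x.
Proof. by rewrite -sub0r Qs_ofB Qs_of0 sub0r. Qed.

Lemma Qs_of_comm x y : j (rcomm x y) = rcomm (j x) (j y).
Proof. by rewrite Qs_ofB !Qs_ofM. Qed.

(** The left maps agree by right linearity of [lact p], the right maps by the balance condition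
    [ract_lact]. *)
Lemma Qs_lactE (p : double_centralizer R) x : dom p x -> Qs_pi p ** j x = j (lact p x).
Proof.
move=> px; rewrite [LHS]Qs_mulE; apply/Qs_piE/dc_eqv_on => y /dc_mul_domP[py _ _ _] _ /=.
by rewrite lactM // ract_lact.
Qed.

Lemma Qs_denominator q :
  exists2 I, nonzero_ideal I & forall x, I x -> exists y, q ** j x = j y.
Proof.
elim/Qs_ind: q => p; exists (dom p); first exact: dom_nz_ideal.
by move=> x px; exists (lact p x); exact: Qs_lactE.
Qed.

(** The left map vanishes on [I] within the domain; [ract_lact] transfers this to the right map, as
    nothing nonzero annihilates a nonzero ideal. *)
Lemma Qs_eq0 I q : nonzero_ideal I -> (forall x, I x -> q ** j x = 0) -> q = 0.
Proof.
move=> nzI; elim/Qs_ind: q => p h.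
have nzK := nz_idealI nzI (dom_nz_ideal p).
have l0 x : I x -> dom p x -> lact p x = 0.
  by move=> Ix px; apply: Qs_of_inj; rewrite Qs_of0 -Qs_lactE // h.
apply/Qs_piE; exists (I `&` dom p); split=> [//|x [_ px]|x [Ix px]] /=; first by split.
rewrite rmul0l rmul0r; split; first exact: l0.
by apply: (ideal_annihilator nzK) => y [Iy py]; rewrite ract_lact // l0 // rmul0r.
Qed.

Lemma Qs_prime x q : x <> 0 -> (forall r, j x ** j r ** q = 0) -> q = 0.
Proof.
move=> x0 h; have [I nzI qI] := Qs_denominator q.
apply: (Qs_eq0 nzI) => y /qI [z qy]; rewrite qy.
suff -> : z = 0 by exact: Qs_of0.
apply: (prime_mul3 x0) => r; apply: Qs_of_inj.
by rewrite Qs_of0 !Qs_ofM -qy rmulA h rmul0l.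
Qed.

(** To commute with [u], test on [x] with [u x] in [R]: then [q u x = u x q = u q x]. *)
Lemma extended_centroidP q : (forall r, q ** j r = j r ** q) -> C q.
Proof.
move=> cq u; have [I nzI uI] := Qs_denominator u.
apply/eqP; rewrite -subr_eq0; apply/eqP; apply: (Qs_eq0 nzI) => x /uI [y ux].
by rewrite rmulBl -!rmulA cq ux rmulA ux cq subrr.
Qed.

(** A bimodule map serves as both left and right map of a double centralizer, which therefore
    commutes with [R]. *)
Lemma Qs_bimodule I (f : R -> R) : nonzero_ideal I ->
  (forall x y, I x -> I y -> f (x + y) = f x + f y) ->
  (forall x r, I x -> f (x ** r) = f x ** r) ->
  (forall r x, I x -> f (r ** x) = r ** f x) ->
  exists2 q, C q & forall x, I x -> q ** j x = j (f x).
Proof.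
move=> nzI fD fr fl.
have flr x y : I x -> I y -> f x ** y = x ** f y by move=> Ix Iy; rewrite -fr // fl.
pose p := @DoubleCentralizer R I f f nzI fD fr fD fl flr.
have pE x : I x -> Qs_pi p ** j x = j (f x) by exact: (@Qs_lactE p).
exists (Qs_pi p) => //; apply: extended_centroidP => r.
apply/eqP; rewrite -subr_eq0; apply/eqP; apply: (Qs_eq0 nzI) => x Ix.
have Irx : I (r ** x) by have [[_ mI] _] := nzI; case: (mI x r Ix).
by rewrite rmulBl -!rmulA -Qs_ofM !pE // fl // Qs_ofM subrr.
Qed.

(* Martindale's lemma: [x |-> y] whenever [c t x = a t y] for all [t] is a
   bimodule map defined on an ideal containing [a], so it is multiplication by
   an element of the extended centroid. *)
Lemma martindale (a b c : R) : a <> 0 -> (forall x, a ** x ** b = c ** x ** a) ->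
  c = b /\ exists2 q, C q & j b = q ** j a.
Proof.
move=> a0 abc; pose G x y := forall t, c ** t ** x = a ** t ** y.
have Guniq x y y' : G x y -> G x y' -> y = y'.
  move=> Gy Gy'; apply/eqP; rewrite -subr_eq0; apply/eqP/(prime_mul3 a0) => r.
  by rewrite rmulBr -Gy -Gy' subrr.
(* The default value 0 is harmless: it occurs only outside the ideal [I] defined below. *)
pose f x := xget 0 (G x); have fP x : (exists y, G x y) -> G x (f x).
  by move=> [y Gy]; exact: xgetI Gy.
have fE x y : G x y -> f x = y by move=> Gy; apply: (Guniq x) => //; apply: fP; exists y.
pose I := [set x | exists y, G x y].
have GB x x' y y' : G x y -> G x' y' -> G (x - x') (y - y').
  by move=> Gy Gy' t; rewrite !rmulBr Gy Gy'.
have GD x x' y y' : G x y -> G x' y' -> G (x + x') (y + y').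
  by move=> Gy Gy' t; rewrite !rmulDr Gy Gy'.
have Gr x y r : G x y -> G (x ** r) (y ** r) by move=> Gy t; rewrite !rmulA Gy.
have Gl x y r : G x y -> G (r ** x) (r ** y).
  by move=> Gy t; move: (Gy (t ** r)); rewrite !rmulA.
have Gab : G a b by move=> t; rewrite abc.
have nzI : nonzero_ideal I.
  split; last by exists a => //; exists b.
  split; first split; first by exists 0 => t; rewrite !rmul0r.
    by move=> x x' [y Gy] [y' Gy']; exists (y - y'); exact: GB.
  by move=> x r [y Gy]; split; [exists (y ** r); exact: Gr|exists (r ** y); exact: Gl].
have [|x r Ix|r x Ix|q Cq qE] := @Qs_bimodule I f nzI.
- by move=> x y Ix Iy; apply/fE/GD; exact: fP.
- by apply/fE/Gr; exact: fP.
- by apply/fE/Gl; exact: fP.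
have qa : j b = q ** j a by rewrite qE ?(fE _ _ Gab) //; exists b.
split; last by exists q.
apply/eqP; rewrite -subr_eq0; apply/eqP; case: (@rng_prime R (c - b) a) => // t.
(* With [b = q a], both [c t a = a t b] and [b t a] equal [q a t a]. *)
apply: Qs_of_inj; rewrite !rmulBl -abc Qs_ofB !Qs_ofM qa Qs_of0.
by rewrite [j a ** j t ** _]rmulA -(Cq (j a ** j t)) !rmulA subrr.
Qed.

(** [R] may lack a unity, so that of [Qs R] is the germ of the identity maps. *)
Definition Qs_one_dc : double_centralizer R.
Proof. by exists [set: R] id id => //; exact: nz_idealT. Defined.

Definition Qs_one : Qs R := Qs_pi Qs_one_dc.

Lemma Qs_mul1 q : Qs_one ** q = q.
Proof. by elim/Qs_ind: q => p; rewrite [LHS]Qs_mulE; apply/Qs_piE/dc_eqv_on. Qed.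

Lemma Qs_mulr1 q : q ** Qs_one = q.
Proof. by elim/Qs_ind: q => p; rewrite [LHS]Qs_mulE; apply/Qs_piE/dc_eqv_on. Qed.

Lemma extended_centroid1 : C Qs_one.
Proof. by move=> q; rewrite Qs_mul1 Qs_mulr1. Qed.

Lemma extended_centroid_ann q x : C q -> x <> 0 -> q ** j x = 0 -> q = 0.
Proof.
move=> Cq x0 qx; have [I nzI qI] := Qs_denominator q.
apply: (Qs_eq0 nzI) => r /qI [y qr]; rewrite qr.
case: (@rng_prime R y x) => // [s|->]; last exact: Qs_of0.
by apply: Qs_of_inj; rewrite !Qs_ofM -qr -!rmulA Cq -!rmulA -Cq qx !rmul0r Qs_of0.
Qed.

(** Choose [x] with [y = q x] nonzero in [R]. Then [y t x = x t y], so Martindale's lemma gives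
    [x = q' y], and [q' q - 1] kills [x]. *)
Lemma extended_centroid_inv q : C q -> q <> 0 -> exists2 q', C q' & q' ** q = Qs_one.
Proof.
move=> Cq q0; have [I nzI qI] := Qs_denominator q.
have [x Ix qx0] : exists2 x, I x & q ** j x <> 0.
  apply: contrapT => h; apply/q0/(Qs_eq0 nzI) => x Ix.
  by apply: contrapT => qx0; apply: h; exists x.
have [y qx] := qI x Ix.
have y0 : y <> 0 by move=> y0; apply: qx0; rewrite qx y0 Qs_of0.
have [t|_ [q' Cq' xy]] := @martindale y x x y0.
  by apply: Qs_of_inj; rewrite !Qs_ofM -qx [RHS]rmulA -(Cq (_ ** _)) !rmulA.
exists q' => //; apply/eqP; rewrite -subr_eq0; apply/eqP.
apply: (@extended_centroid_ann _ x).
- by apply: (subgroupB (central_subgroup _)); [exact: centerM|exact: extended_centroid1].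
- by move=> x0; apply: qx0; rewrite x0 Qs_of0 rmul0r.
by rewrite rmulBl -rmulA qx -xy Qs_mul1 subrr.
Qed.

End Quotients.

(** * Noncentral abelian Lie ideals: the equality [LC = Cb + C] *)

Section AbelianLieIdeals.
Variables (R : primeRngType) (L : set R) (b : R).
Hypotheses (lieL : lie_ideal L) (abL : abelian_lie L) (Lb : L b) (nb : ~ center b).
Local Notation j := (@Qs_of R).
Local Notation C := (@extended_centroid R).
Local Notation RC := (central_span [set: R]).
Local Notation LC := (central_span L).
Local Notation K := [set beta ** j b + gamma | beta in C & gamma in C].
Implicit Types (a x y z r s u v : R) (q k : Qs R).
Local Opaque rcomm.

Lemma noncentral_rcomm : exists r, rcomm b r <> 0.
Proof. by apply/existsNP => h; apply: nb => r; apply/rcomm_eq0. Qed.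

Lemma subgroupC : additive_subgroup C. Proof. exact: central_subgroup. Qed.

Lemma subgroupK : additive_subgroup K.
Proof.
have sgC := subgroupC; split.
  by exists 0; [|exists 0]; rewrite ?rmul0l ?addr0 //; exact: (subgroup0 sgC).
move=> _ _ [f Cf [g Cg <-]] [f' Cf' [g' Cg' <-]].
exists (f - f'); first exact: (subgroupB sgC).
by exists (g - g'); [exact: (subgroupB sgC)|rewrite rmulBl opprD addrACA].
Qed.

Lemma mulK q c : K q -> C c -> K (q ** c).
Proof.
move=> [f Cf [g Cg <-]] Cc; exists (f ** c); first exact: centerM.
exists (g ** c); first exact: centerM.
by rewrite rmulDl -!rmulA (Cc (j b)).
Qed.

Lemma commK q k : q ** j b = j b ** q -> K k -> q ** k = k ** q.
Proof.
move=> qb [f Cf [g Cg <-]].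
by rewrite rmulDl rmulDr Cg rmulA -(Cf q) -!rmulA qb.
Qed.

Lemma centralizer_comm_sub u : (forall x, rcomm u (rcomm b x) = 0) -> K (j u).
Proof.
move=> hu; have [r0 br0] := noncentral_rcomm.
(* This is [[u, -]] applied to [[b, xy] = [b,x] y + x [b,y]]; replacing [y] by [yz] then gives
   [h3]. *)
have h x y : rcomm b x ** rcomm u y + rcomm u x ** rcomm b y = 0.
  by have := hu (x ** y); rewrite rcommMr rcommDr !rcommMr !hu rmul0l rmul0r add0r addr0.
have h3 x y z : rcomm b x ** y ** rcomm u z = - (rcomm u x ** y ** rcomm b z).
  apply/eqP; rewrite -addr_eq0; have := h x (y ** z); rewrite !rcommMr !rmulDr !rmulA.
  by rewrite addrACA -rmulDl h rmul0l add0r => ->.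
(* Besides the scalar [f], Martindale's lemma yields [E], which says that [[u,r0]] equals its own
   negative; this absorbs the sign in [h3], in any characteristic. *)
have [x|E [f Cf fE]] := martindale br0 (c := - rcomm u r0) (b := rcomm u r0).
  by rewrite h3 !rmulNl.
have uf z : j (rcomm u z) = f ** j (rcomm b z).
  apply/eqP; rewrite -subr_eq0; apply/eqP; apply: (Qs_prime br0) => y.
  rewrite rmulBr -!Qs_ofM h3 -!rmulNl E !Qs_ofM fE.
  by rewrite rmulNl [X in _ - X]rmulA -(Cf (_ ** _)) !rmulA subrr.
exists f => //; exists (j u - f ** j b); last by rewrite addrC subrK.
apply: extended_centroidP => r; apply/rcomm_eq0.
rewrite rcommBl rcommMl -!Qs_of_comm uf.
rewrite (_ : rcomm f (j r) = 0) ?rmul0l ?addr0 ?subrr //.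
exact/rcomm_eq0.
Qed.

Lemma lie_subK x : L x -> K (j x).
Proof.
move=> Lx; apply: centralizer_comm_sub => y.
by apply: (abelian_rcomm abL) => //; exact: lie_rcomm.
Qed.

(** Commuting with [b], [a] commutes with all of [K], hence with every [[b,x]], which lies in
    [L]. *)
Lemma centralizer_subK a : rcomm a b = 0 -> K (j a).
Proof.
move=> /rcomm_eq0 ab; apply: centralizer_comm_sub => x; apply/rcomm_eq0/Qs_of_inj.
rewrite !Qs_ofM; apply: commK; first by rewrite -!Qs_ofM ab.
by apply: lie_subK; exact: lie_rcomm.
Qed.

Lemma rcomm_bK q k : K k -> exists2 f, C f & exists2 g, C g &
  k = f ** j b + g /\ rcomm k q = f ** rcomm (j b) q.
Proof.
move=> [f Cf [g Cg <-]]; exists f => //; exists g => //; split=> //.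
have c0 c : C c -> rcomm c q = 0 by move=> Cc; apply/rcomm_eq0.
by rewrite rcommDl rcommMl (c0 f) // (c0 g) // rmul0l !addr0.
Qed.

Lemma central_span_mem (A : set R) x c : A x -> C c -> central_span A (j x ** c).
Proof. by move=> Ax Cc; apply: sub_add_span; exists (j x); [exists x|exists c]. Qed.

Lemma central_span_of (A : set R) x : A x -> central_span A (j x).
Proof.
move=> Ax; rewrite -[j x]Qs_mulr1; apply: central_span_mem => //.
exact: extended_centroid1.
Qed.

Lemma comm_RC q : RC q -> K (rcomm (j b) q).
Proof.
apply: (@add_span_sub _ _ [set q | K (rcomm (j b) q)]).
  split=> [|x y Kx Ky] /=; last by rewrite rcommBr; exact: (subgroupB subgroupK).
  have -> : rcomm (j b) 0 = 0 by apply/rcomm_eq0; rewrite rmul0l rmul0r.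
  exact: (subgroup0 subgroupK).
move=> _ [_ [x _ <-] [c Cc <-]] /=; rewrite rcommMr.
have -> : rcomm (j b) c = 0 by apply/rcomm_eq0; rewrite Cc.
rewrite rmul0r addr0 -Qs_of_comm; apply: mulK => //.
by apply: lie_subK; exact: lie_rcomm.
Qed.

(** If [[b,q] = f b + g] and [[b,k] = f' b + g'], the Jacobi identity gives [f [b,k] - f' [b,q] = f
    g' - f' g]: the terms in [b] cancel. *)
Lemma comm_comm_RC q k : RC q -> RC k -> C (rcomm (j b) (rcomm q k)).
Proof.
move=> /comm_RC /(rcomm_bK k) [f Cf [g Cg [Eq Eqk]]].
move=> /comm_RC /(rcomm_bK q) [f' Cf' [g' Cg' [Ek Ekq]]].
rewrite rcomm_jacobi Eqk [rcomm q _]rcomm_anti Ekq Eq Ek !rmulDr !rmulA (Cf f').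
rewrite opprD addrACA subrr add0r.
by apply: (subgroupB subgroupC); exact: centerM.
Qed.

Lemma comm_comm_span q : set_comm RC RC q -> C (rcomm (j b) q).
Proof.
apply: (@add_span_sub _ _ [set q | C (rcomm (j b) q)]).
  split=> [|x y Kx Ky] /=; last by rewrite rcommBr; exact: (subgroupB subgroupC).
  have -> : rcomm (j b) 0 = 0 by apply/rcomm_eq0; rewrite rmul0l rmul0r.
  exact: (subgroup0 subgroupC).
by move=> _ [x Rx [y Ry <-]] /=; exact: comm_comm_RC.
Qed.

(** Otherwise, replacing [y] by [b y] gives [[b,x] [b,y] = 0] on [I]. Primeness then forces [[b,x] =
    0] on [I], and finally [[b,r0] = 0]. *)
Lemma comm_comm_neq0 (I : set R) : nonzero_ideal I ->
  exists x y, [/\ I x, I y & rcomm b (rcomm x y) <> 0].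
Proof.
move=> nzI; have [[sgI mI] _] := nzI; apply: contrapT => h.
have {}h x y : I x -> I y -> rcomm b (rcomm x y) = 0.
  by move=> Ix Iy; apply: contrapT => xy0; apply: h; exists x, y.
have bb x : rcomm b (rcomm b x) = 0.
  by apply: (abelian_rcomm abL) => //; exact: lie_rcomm.
have h2 x y : I x -> I y -> rcomm b x ** rcomm b y = 0.
  move=> Ix Iy; have Iby : I (b ** y) by case: (mI y b Iy).
  have := h _ _ Ix Iby; rewrite rcommMr rcommDr !rcommMr (h x y) // rmul0r addr0.
  have -> : rcomm b b = 0 by exact/rcomm_eq0.
  rewrite rmul0l addr0 [rcomm x b]rcomm_anti rcommNr bb oppr0 rmul0l add0r rmulNl.
  by move/eqP; rewrite oppr_eq0 => /eqP.
have [r0 br0] := noncentral_rcomm.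
have h3 x : I x -> rcomm b x = 0.
  move=> Ix; apply: (ideal_annihilator nzI) => y Iy.
  case: (@rng_prime R (rcomm b x ** y) (rcomm b r0)) => // s.
  have [Iys _] := mI y s Iy; have [Iysr _] := mI _ r0 Iys.
  by have := h2 _ _ Ix Iysr; rewrite rcommMr rmulDr !rmulA h2 // rmul0l add0r.
apply/br0/(ideal_annihilator nzI) => y Iy; have [_ Ir0y] := mI y r0 Iy.
by have := h3 _ Ir0y; rewrite rcommMr (h3 y) // rmul0r addr0.
Qed.

Lemma ideal_scalar (I : set R) : nonzero_ideal I ->
  exists x y c, [/\ I x, I y, C c & j (rcomm b (rcomm x y)) ** c = Qs_one R].
Proof.
move=> nzI; have [x [y [Ix Iy xy0]]] := comm_comm_neq0 nzI.
have Cxy : C (j (rcomm b (rcomm x y))).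
  by rewrite !Qs_of_comm; apply: comm_comm_RC; exact: central_span_of.
have [|c Cc cxy] := extended_centroid_inv Cxy.
  by rewrite -(Qs_of0 R) => /Qs_of_inj.
by exists x, y, c; split=> //; rewrite Cxy.
Qed.

Lemma LC_eqK : LC = K.
Proof.
rewrite eqEsubset; split.
  apply: add_span_sub; first exact: subgroupK.
  by move=> _ [_ [x Lx <-] [c Cc <-]]; apply: mulK => //; exact: lie_subK.
move=> _ [f Cf [g Cg <-]]; apply: (subgroupD (add_span_subgroup _)).
  by rewrite Cf; exact: central_span_mem.
(* The scalar [[b,[x,y]]] lies in [L] and is invertible in [C], so [LC] contains 1 and all of
   [C]. *)
have [x [y [c [_ _ Cc xyc]]]] := ideal_scalar (nz_idealT R).
rewrite -[g]Qs_mul1 -xyc -rmulA; apply: central_span_mem; last exact: centerM.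
exact: lie_rcomm.
Qed.

(** * Units of [RC] and ideals inside [L + a L] *)

Lemma central_spanS (A B : set R) : A `<=` B -> central_span A `<=` central_span B.
Proof.
move=> AB; apply: add_span_sub; first exact: add_span_subgroup.
by move=> _ [_ [x Ax <-] [c Cc <-]]; apply: central_span_mem => //; exact: AB.
Qed.

Lemma C_sub_RC c : C c -> RC c.
Proof.
move=> Cc; apply: (@central_spanS L); first exact: subsetT.
rewrite LC_eqK; exists 0; first exact: (subgroup0 subgroupC).
by exists c; rewrite ?rmul0l ?add0r.
Qed.

Lemma unit_RC q q' : RC q -> RC q' -> q ** q' = Qs_one R -> q' ** q = Qs_one R ->
  unit_of RC q.
Proof.
move=> Rq Rq' qq' q'q; exists (Qs_one R); last by split=> //; exists q'.
split; first by apply: C_sub_RC; exact: extended_centroid1.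
by move=> x _; rewrite Qs_mul1 Qs_mulr1.
Qed.

(** Here [a] commutes with [b], so [L + a L] centralizes [b]. An ideal [I] inside it would give
    [[b,r] x = [b, r x] = 0] for [x] in [I], making [b] central. *)
Lemma LC_contains_no_ideal a : LC (j a) -> ~ contains_nz_ideal (add_lmul a L).
Proof.
rewrite LC_eqK => /(commK erefl) ba [I nzI IS].
have bI x : I x -> b ** x = x ** b.
  move=> /IS [u Lu [v Lv <-]].
  have bL y : L y -> b ** y = y ** b by move=> Ly; apply/rcomm_eq0/(abelian_rcomm abL).
  have {}ba : b ** a = a ** b by apply: Qs_of_inj; rewrite !Qs_ofM.
  by rewrite rmulDl rmulDr bL // rmulA ba -!rmulA bL.
apply: nb => r; apply/rcomm_eq0/(ideal_annihilator nzI) => x Ix.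
have Irx : I (r ** x) by case: nzI => [[_ /(_ x r Ix) []]].
have := rcommMr b r x; have -> : rcomm b x = 0 by apply/rcomm_eq0; exact: bI.
by rewrite rmul0r addr0 => <-; apply/rcomm_eq0; exact: bI.
Qed.

Lemma contains_ideal_unit a :
  contains_nz_ideal (add_lmul a L) -> unit_of RC (j (rcomm a b)).
Proof.
move=> [I nzI IS]; have [x [y [c [Ix Iy Cc xyc]]]] := ideal_scalar nzI.
have [[sgI mI] _] := nzI.
have [u Lu [v Lv xyE]] : add_lmul a L (rcomm x y).
  by apply: IS; apply: (subgroupB sgI); have [] := mI x y Ix.
have bL z : L z -> rcomm b z = 0 by move=> Lz; apply: (abelian_rcomm abL).
have Lab : L (rcomm a b) by exact: lie_rcommr.
have abv : rcomm a b ** (- v) = rcomm b (rcomm x y).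
  rewrite -xyE rcommDr rcommMr (bL u) // (bL v) // rmul0r addr0 add0r.
  by rewrite [rcomm b a]rcomm_anti rmulNl rmulNr.
have abvc : j (rcomm a b) ** (j (- v) ** c) = Qs_one R.
  by rewrite rmulA -Qs_ofM abv.
apply: (unit_RC _ _ abvc); try exact: central_span_of; first exact: central_span_mem.
(* The right inverse is also a left inverse because [[a,b]] and [- v] both lie in the abelian
   [L]. *)
rewrite -abvc -rmulA Cc !rmulA -!Qs_ofM; congr (j _ ** _).
by apply/rcomm_eq0/(abelian_rcomm abL) => //; exact: (subgroupN (lie_sub lieL)).
Qed.

Lemma unit_contains_ideal a :
  unit_of RC (j (rcomm a b)) -> contains_nz_ideal (add_lmul a L).
Proof.
move=> [e [Re e1] [_ [v _ [cv vc]]]].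
have {Re e1} e1 : e = Qs_one R.
  apply/eqP; rewrite -subr_eq0; apply/eqP; apply: (Qs_eq0 (nz_idealT R)) => x _.
  by rewrite rmulBl Qs_mul1; have [-> _] := e1 (j x) (central_span_of I); rewrite subrr.
move: cv vc; rewrite {}e1 => cv vc.
have bb x : rcomm b (rcomm x b) = 0.
  by apply: (abelian_rcomm abL) => //; exact: lie_rcommr.
(* [[a,b]] is in [L] and so commutes with [b]; its inverse [v] does too. *)
have vb : rcomm v (j b) = 0.
  have /rcomm_eq0 bc : rcomm (j b) (j (rcomm a b)) = 0 by rewrite -Qs_of_comm bb Qs_of0.
  apply/rcomm_eq0; rewrite -[v ** j b]Qs_mulr1 -cv -rmulA [_ ** (j _ ** v)]rmulA bc.
  by rewrite !rmulA vc Qs_mul1.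
pose w := j a ** v; have wb : rcomm w (j b) = Qs_one R.
  by rewrite rcommMl vb rmul0r add0r -Qs_of_comm.
have wk k z : rcomm k (j b) = 0 -> w ** k = j z -> k = j (rcomm z b).
  by move=> kb wkz; rewrite Qs_of_comm -wkz rcommMl kb rmul0r add0r wb Qs_mul1.
(* The three denominators bring [w y], [w k2] and [w a k2] into [R], where [k2 = v [y,b]]; then
   [w k1 = w y - w a k2] is in [R] as well. *)
have [I1 nzI1 I1w] := Qs_denominator w.
have [I2 nzI2 I2w] := Qs_denominator (w ** v).
have [I3 nzI3 I3w] := Qs_denominator (w ** j a ** v).
have nzI := nz_idealI nzI1 (nz_idealI nzI2 nzI3).
exists (I1 `&` (I2 `&` I3)) => // y Iy.
have [_ [I2y I3y]] : (I1 `&` (I2 `&` I3)) (rcomm y b).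
  have [[sgI mI] _] := nzI.
  by apply: (subgroupB sgI); have [] := mI y b Iy.
have [I1y _] := Iy; have [z1 w1] := I1w _ I1y.
have [z2 w2] := I2w _ I2y; have [z3 w3] := I3w _ I3y.
have kb : rcomm (v ** j (rcomm y b)) (j b) = 0.
  by rewrite rcommMl vb rmul0l -Qs_of_comm rcomm_anti bb oppr0 Qs_of0 rmul0r addr0.
have k2 : v ** j (rcomm y b) = j (rcomm z2 b) by apply: wk; rewrite // rmulA.
have k1 : j (y - a ** rcomm z2 b) = j (rcomm (z1 - z3) b).
  rewrite Qs_ofB Qs_ofM -k2; apply: wk; last by rewrite rmulBr w1 !rmulA w3 Qs_ofB.
  (* [k1] commutes with [b] since [[a k2, b] = [a,b] v [y,b] = [y,b]]. *)
  by rewrite rcommBl rcommMl kb rmul0r add0r -!Qs_of_comm rmulA cv Qs_mul1 subrr.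
exists (rcomm (z1 - z3) b); first exact: lie_rcommr.
exists (rcomm z2 b); first exact: lie_rcommr.
by rewrite -(Qs_of_inj k1) subrK.
Qed.

(** [[a,b]] is a scalar; were it zero, [a] would centralize [b] and so lie in [Cb + C = LC]. *)
Lemma comm_RC_unit a : set_comm RC RC (j a) -> ~ LC (j a) -> unit_of RC (j (rcomm a b)).
Proof.
move=> /comm_comm_span; rewrite -Qs_of_comm => Cba; rewrite LC_eqK => nKa.
have Cab : C (j (rcomm a b)).
  by rewrite rcomm_anti Qs_ofN; exact: (subgroupN subgroupC).
have [ab0|c Cc cab] := extended_centroid_inv Cab.
  by apply/nKa/centralizer_subK/Qs_of_inj; rewrite Qs_of0.
by apply: (@unit_RC _ c) => //; rewrite ?[j _ ** c]Cab //; exact: C_sub_RC.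
Qed.

End AbelianLieIdeals.

Theorem theoremB (R : primeRngType) (L : set R) (a : R)
    (lieL : lie_ideal L) (noncentralL : ~ (L `<=` @center R)) :
  let C := @extended_centroid R in
  let RC := central_span [set: R] in
  let LC := central_span L in
  (~ abelian_lie L -> ~ center a -> contains_nz_ideal (add_lmul a L)) /\
  (abelian_lie L ->
    exists b : R,
      [/\ L b /\ ~ center b,
          LC = [set beta ** Qs_of b + gamma | beta in C & gamma in C],
          LC (Qs_of a) -> ~ contains_nz_ideal (add_lmul a L),
          set_comm RC RC (Qs_of a) -> ~ LC (Qs_of a) ->
            contains_nz_ideal (add_lmul a L) &
          ~ set_comm RC RC (Qs_of a) ->
            (contains_nz_ideal (add_lmul a L) <->
             unit_of RC (Qs_of (rcomm a b)))]).
Proof.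
move=> C RC LC; split; first exact: nonabelian_contains_nz_ideal.
move=> abL; have [b [Lb nb]] : exists b, L b /\ ~ center b.
  apply: contrapT => h; apply: noncentralL => b Lb.
  by apply: contrapT => nb; apply: h; exists b.
exists b; split=> //.
- exact: (LC_eqK lieL abL Lb nb).
- exact: (LC_contains_no_ideal lieL abL Lb nb).
- move=> Ra La; apply: (unit_contains_ideal lieL abL Lb).
  exact: (comm_RC_unit lieL abL Lb nb).
- move=> _; split; first exact: (contains_ideal_unit lieL abL Lb nb).
  exact: (unit_contains_ideal lieL abL Lb).
Qed.
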